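(* Let $H$ be a connected hypergraph with a minimal edge cut $F$, and let $\{ V_0, V_1 \}$ be a partition of $V(H)$ such that each of $V_0,V_1$ is a union of the vertex sets of connected components of $H \backslash F$. Then $H$ admits an Euler family if and only if there exists an edge cut assignment $\alpha: F \to \mathbb{Z}_2^{[2]}$ such that $|\alpha^{-1}(01)|$ is even, and either (i) $\alpha^{-1}(01) = \emptyset$ and $H^{\alpha}[V_i]$ has an Euler family for each $i \in \mathbb{Z}_2$, or (ii) $\alpha^{-1}(01) \ne \emptyset$, and for each $i \in \mathbb{Z}_2$, the collapsed hypergraph $H^{\alpha} \circ V_i$ has an Euler family that traverses its collapsed vertex $u_i^{\circ}$ via each of the edges in $\{ (f^{\alpha})^{\circ}: f \in \alpha^{-1}(01) \}$.
   Context: A hypergraph $H=(V,E)$: non-empty finite vertex set $V$ and finite multiset $E$ of subsets of $V$ (edges). Distinct $u,v$ are adjacent via $e$ if $u,v\in e$. A walk is $v_0e_1v_1\ldots e_kv_k$ with $v_{i-1},v_i$ adjacent via $e_i$; anchors are $v_0,\dots,v_k$; closed if $v_0=v_k$, $k\ge2$; trail if edges are pairwise distinct; it traverses vertex $v$ via edge $e$ if $ev$ or $ve$ is a consecutive subsequence. Connected components are maximal connected subhypergraphs without empty edges. An Euler family is a set of pairwise edge-disjoint and anchor-disjoint closed trails jointly traversing every edge. For $V'\subseteq V$, $H[V']$ has vertex set $V'$ and edge multiset $\{\!\{e\cap V': e\in E, e\cap V'\ne\emptyset\}\!\}$. For $F\subseteq E$, $H\backslash F=(V,E-F)$. An edge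 cut is a set $[S,V-S]_H=\{e\in E: e\cap S\ne\emptyset\ne e\cap(V-S)\}$ for non-empty proper $S\subset V$; minimal if it properly contains no other edge cut. $\mathbb{Z}_2^{[2]}=\{00,01,11\}$ denotes unordered pairs from $\mathbb{Z}_2=\{0,1\}$ with repetition. An edge cut assignment $\alpha:F\to\mathbb{Z}_2^{[2]}$ satisfies: $\alpha(f)=01$ implies $f\cap V_0\ne\emptyset\ne f\cap V_1$, and $\alpha(f)=ii$ implies $|f\cap V_i|\ge 2$. For $e\in E$: $e^\alpha=e\cap(V_i\cup V_j)$ if $e\in F$, $\alpha(e)=ij$; $e^\alpha=e$ if $e\notin F$. $H^\alpha$ has vertex set $V(H)$ and edge multiset $\{\!\{e^\alpha:e\in E(H)\}\!\}$. For a hypergraph $K$ and $\emptyset\ne S\subsetneq V(K)$, the collapsed hypergraph $K\circ S$ has vertex set $(V(K)-S)\cup\{u^\circ\}$, where $u^\circ$ is a new vertex (the collapsed vertex), and edge multiset $\{\!\{e^\circ: e\in E(K), |e\cap(V(K)-S)|\ge1\}\!\}$, where $e^\circ=e$ if $e\cap S=\emptyset$ and $e^\circ=(e-S)\cup\{u^\circ\}$ otherwise. The collapsed vertex of $H^\alpha\circ V_i$ is denoted $u_i^\circ$.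
   Formalization: The formal theorem additionally assumes that H has no empty edges; with an empty edge the claim fails, since H then has no Euler family while the empty edge disappears from the hypergraphs H^α[V_i] and H^α∘V_i. *)

(* Defs.v *)
From HB Require Import structures.
From mathcomp Require Import all_boot.

Set Implicit Arguments.
Unset Strict Implicit.
Unset Printing Implicit Defensive.

(* The edge multiset is a family of subsets indexed by a finite type, so parallel
   edges are distinct elements of [edge H]. *)
Record hypergraph := Hypergraph {
  vert : finType;
  edge : finType;
  inc : edge -> {set vert};
  vert_gt0 : 0 < #|vert|
}.

(* An empty edge lies on no trail, but it disappears from H[U] and H o S; hence the
   reduction of Euler families along an edge cut requires H to have none. *)
Definition no_empty_edges (H : hypergraph) : Prop :=
  forall e : edge H, inc e != set0.

Section Walks.
Variable H : hypergraph.

Definition adj_via (e : edge H) (u v : vert H) : bool :=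
  [&& u != v, u \in inc e & v \in inc e].

(* [(v0, [:: (e1, v1); ...; (ek, vk)])] stands for v0 e1 v1 ... ek vk. *)
Definition walk_data : Type := (vert H * seq (edge H * vert H))%type.

Fixpoint walk_from (u : vert H) (p : seq (edge H * vert H)) : bool :=
  if p is (e, v) :: p' then adj_via e u v && walk_from v p' else true.

Definition is_walk (W : walk_data) : bool := walk_from W.1 W.2.

Definition walk_start (W : walk_data) : vert H := W.1.
Definition walk_end (W : walk_data) : vert H := last W.1 (unzip2 W.2).
Definition anchors (W : walk_data) : seq (vert H) := W.1 :: unzip2 W.2.
Definition walk_edges (W : walk_data) : seq (edge H) := unzip1 W.2.

Definition is_trail (W : walk_data) : bool := is_walk W && uniq (walk_edges W).

Definition is_closed (W : walk_data) : bool :=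
  (walk_start W == walk_end W) && (2 <= size W.2).

Definition is_closed_trail (W : walk_data) : bool := is_trail W && is_closed W.

Fixpoint traverses_from (u : vert H) (p : seq (edge H * vert H))
    (x : vert H) (e : edge H) : bool :=
  if p is (f, v) :: p' then
    [|| (u == x) && (f == e), (f == e) && (v == x) | traverses_from v p' x e]
  else false.

(* [x e] or [e x] is a consecutive subsequence of W. *)
Definition traverses_via (W : walk_data) (x : vert H) (e : edge H) : bool :=
  traverses_from W.1 W.2 x e.

Definition connected : Prop :=
  forall u v : vert H,
    exists W : walk_data, [/\ is_walk W, walk_start W = u & walk_end W = v].

Definition euler_family (T : seq walk_data) : Prop :=
  [/\ uniq T,
      {in T, forall W, is_closed_trail W},
      {in T &, forall W W', W != W' -> ~~ has (mem (walk_edges W)) (walk_edges W')},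
      {in T &, forall W W', W != W' -> ~~ has (mem (anchors W)) (anchors W')}
    & forall e : edge H, exists2 W, W \in T & e \in walk_edges W].

Definition has_euler_family : Prop := exists T : seq walk_data, euler_family T.

End Walks.

Section Subhypergraphs.
Variable H : hypergraph.

Lemma card_subvert_gt0 (U : {set vert H}) :
  U != set0 -> 0 < #|{: {x : vert H | x \in U}}|.
Proof. by rewrite card_sig -card_gt0. Qed.

(* Vertex set U, edges e :&: U for e in D. *)
Definition subhypergraph (U : {set vert H}) (U0 : U != set0)
    (D : {set edge H}) : hypergraph :=
  @Hypergraph {x : vert H | x \in U} {e : edge H | e \in D}
    (fun e => [set x | val x \in inc (val e)])
    (card_subvert_gt0 U0).

Definition induced (U : {set vert H}) (U0 : U != set0) : hypergraph :=
  subhypergraph U0 [set e | inc e :&: U != set0].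

Definition delete_edges (F : {set edge H}) : hypergraph :=
  @Hypergraph (vert H) {e : edge H | e \notin F}
    (fun e => inc (val e)) (vert_gt0 H).

Definition connected_sub (U : {set vert H}) (D : {set edge H}) : Prop :=
  exists U0 : U != set0,
    connected (subhypergraph U0 D) /\ no_empty_edges (subhypergraph U0 D).

Definition is_component (U : {set vert H}) (D : {set edge H}) : Prop :=
  connected_sub U D /\
  forall (U' : {set vert H}) (D' : {set edge H}),
    U \subset U' -> D \subset D' -> connected_sub U' D' -> U' = U /\ D' = D.

Definition union_of_components (A : {set vert H}) : Prop :=
  exists2 P : {set {set vert H}},
    forall U, U \in P -> exists D, is_component U D
    & A = \bigcup_(U in P) U.

Definition cut (S : {set vert H}) : {set edge H} :=
  [set e | (inc e :&: S != set0) && (inc e :&: ~: S != set0)].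

Definition is_edge_cut (F : {set edge H}) : bool :=
  [exists S : {set vert H}, [&& S != set0, S \proper [set: vert H] & F == cut S]].

Definition minimal_edge_cut (F : {set edge H}) : bool := minset is_edge_cut F.

(* The collapsed vertex is [None]. *)
Definition collapse (S : {set vert H}) : hypergraph :=
  @Hypergraph (option {x : vert H | x \notin S})
    {e : edge H | 1 <= #|inc e :\: S|}
    (fun e => [set y | if y is Some x then val x \in inc (val e)
                       else inc (val e) :&: S != set0])
    (eq_ind_r (leq 1) (ltn0Sn _) (card_option _)).

Definition collapsed_vertex (S : {set vert H}) : vert (collapse S) := None.

End Subhypergraphs.

(* The unordered pairs with repetition from Z_2; elements of Z_2 are booleans, with
   0 = false and 1 = true. *)
Inductive Z2pair := p00 | p01 | p11.

Definition Z2pair_ends (a : Z2pair) : bool * bool :=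
  match a with
  | p00 => (false, false)
  | p01 => (false, true)
  | p11 => (true, true)
  end.

Definition Z2pair_of_ends (ij : bool * bool) : Z2pair :=
  match ij with
  | (false, false) => p00
  | (true, true) => p11
  | _ => p01
  end.

Lemma Z2pair_endsK : cancel Z2pair_ends Z2pair_of_ends.
Proof. by case. Qed.

HB.instance Definition _ := Equality.copy Z2pair (can_type Z2pair_endsK).

Section EdgeCutAssignments.
Variables (H : hypergraph) (F : {set edge H}) (V : bool -> {set vert H}).

Definition edge_cut_assignment (alpha : {f : edge H | f \in F} -> Z2pair) : Prop :=
  forall f,
    [/\ alpha f = p01 ->
          inc (val f) :&: V false != set0 /\ inc (val f) :&: V true != set0,
        alpha f = p00 -> 2 <= #|inc (val f) :&: V false|
      & alpha f = p11 -> 2 <= #|inc (val f) :&: V true|].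

Variable alpha : {f : edge H | f \in F} -> Z2pair.

Definition assigned_edge (e : edge H) : {set vert H} :=
  if (insub e : option {f : edge H | f \in F}) is Some f then
    let: (i, j) := Z2pair_ends (alpha f) in inc e :&: (V i :|: V j)
  else inc e.

Definition assigned : hypergraph :=
  @Hypergraph (vert H) (edge H) assigned_edge (vert_gt0 H).

Definition preimage (a : Z2pair) : {set {f : edge H | f \in F}} :=
  [set f | alpha f == a].

(* H^alpha o V_i has an Euler family traversing its collapsed vertex via
   (f^alpha)^o for every f with alpha f = 01; g is (f^alpha)^o, i.e. f seen as an
   edge of the collapsed hypergraph. *)
Definition collapse_euler (i : bool) : Prop :=
  exists2 T : seq (walk_data (collapse (H := assigned) (V i))), euler_family T &
    forall f, f \in preimage p01 ->
      exists2 g : edge (collapse (H := assigned) (V i)), val g = val f &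
        exists2 W, W \in T &
          traverses_via W (collapsed_vertex (H := assigned) (V i)) g.

End EdgeCutAssignments.

(* Main.v *)
Require Import Defs.
From mathcomp Require Import all_boot.

Set Implicit Arguments.
Unset Strict Implicit.
Unset Printing Implicit Defensive.

(** An Euler family amounts to a choice of two vertices in each edge such that the
    resulting multigraph has only even degrees. Given such a choice, start from the
    one-edge trails and keep merging: by parity, a trail with an end x different from
    its start can be continued by another trail with an end at x, and two closed
    trails sharing an anchor can be spliced there; when nothing can be merged, the
    trails form an Euler family.

    An edge outside F cannot meet both V_0 and V_1, since a component of H \ F
    contains every edge it meets. An even choice on H thus restricts to each side: the
    edges chosen across the cut are those with alpha = 01, their number is even by
    double counting, and this is the degree of the collapsed vertex. Conversely, even
    choices on the two sides glue, because an edge with alpha = 01 contributes one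
    vertex other than the collapsed one on each side. *)

(** * Pairwise relations and concatenations of sequences *)

Section SeqFacts.
Variables (T S : eqType).

Lemma pairwise_sym_in (r : rel T) (s : seq T) :
  symmetric r -> pairwise r s -> {in s &, forall x y, x != y -> r x y}.
Proof.
move=> rC; elim: s => //= z s IHs /andP[/allP rz /IHs rs] x y.
rewrite !inE => /predU1P[->|xs] /predU1P[->|ys]; rewrite ?eqxx //.
- by move=> _; apply: rz.
- by move=> _; rewrite rC; apply: rz.
- exact: rs.
Qed.

(** A permutation puts the offending pair in front, the form in which two trails get merged. *)
Lemma pairwiseN (r : rel T) (s : seq T) : ~~ pairwise r s ->
  exists x y t, perm_eq s [:: x, y & t] /\ ~~ r x y.
Proof.
elim: s => //= z s IHs; rewrite negb_and => /orP[/allPn[y ys rzy]|/IHs].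
  by exists z, y, (rem y s); split; rewrite // perm_cons perm_to_rem.
case=> x [y [t [pst rxy]]]; exists x, y, (z :: t); split=> //.
by rewrite perm_sym (perm_catCA [:: x; y] [:: z] t) /= perm_cons perm_sym.
Qed.

Lemma uniq_flatten_map (f : T -> seq S) (s : seq T) :
    uniq s -> {in s, forall x, uniq (f x)} ->
    {in s &, forall x y, x != y -> ~~ has (mem (f x)) (f y)} ->
  uniq (flatten (map f s)).
Proof.
elim: s => //= x s IHs /andP[xs us] uf df; rewrite cat_uniq uf ?mem_head //=.
rewrite IHs // ?andbT.
- apply/hasPn => e /flatten_mapP[y ys efy].
  have: ~~ has (mem (f x)) (f y).
    by apply: df; rewrite ?mem_head ?inE ?ys ?orbT //; apply: contraNneq xs => ->.
  by move/hasPn/(_ e efy).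
- by move=> y ys; apply: uf; rewrite inE ys orbT.
- by move=> y z ys zs; apply: df; rewrite inE ?ys ?zs orbT.
Qed.

Lemma uniq_flatten_mem (ss : seq (seq S)) (s : seq S) :
  uniq (flatten ss) -> s \in ss -> uniq s.
Proof.
elim: ss => //= t ss IHss; rewrite cat_uniq => /and3P[ut _ uss].
by rewrite inE => /predU1P[->|/IHss->].
Qed.

Lemma odd_count_flatten (a : pred S) (ss : seq (seq S)) :
  odd (count a (flatten ss)) -> exists2 s, s \in ss & odd (count a s).
Proof.
elim: ss => //= t ss IHss; rewrite count_cat oddD.
have [odt _|_ /=] := boolP (odd (count a t)); first by exists t; rewrite ?mem_head.
by case/IHss => s sss ods; exists s; rewrite // inE sss orbT.
Qed.

End SeqFacts.

(* The graph obtained from [H] by shrinking each edge [e] to the pair [c e] has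
   only even degrees. *)
Definition even_selection (H : hypergraph) (c : edge H -> {set vert H}) : Prop :=
  [/\ forall e, c e \subset inc e, forall e, #|c e| = 2
    & forall x, ~~ odd #|[set e | x \in c e]|].

(** * Trails through a fixed choice of two vertices per edge, and their merging *)

Section SelectedWalks.
Variables (H : hypergraph) (c : edge H -> {set vert H}).
Implicit Types (u x : vert H) (e : edge H) (p q : seq (edge H * vert H)).
Implicit Types (W : walk_data H) (T : seq (walk_data H)).

(** The choice [c] fixes the two ends of every step. Incidence and distinctness of the ends are left
    to the hypotheses on [c], so that splicing and reversal concern [c] alone. *)
Fixpoint selwalk u p : bool :=
  if p is (e, v) :: p' then (c e == [set u; v]) && selwalk v p' else true.

Fixpoint rev_steps u p : seq (edge H * vert H) :=
  if p is (e, v) :: p' then rcons (rev_steps v p') (e, u) else [::].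

Lemma selwalk_cat u p q :
  selwalk u (p ++ q) = selwalk u p && selwalk (last u (unzip2 p)) q.
Proof. by elim: p u => //= -[e v] p IHp u /=; rewrite IHp andbA. Qed.

Lemma last_rev_steps u p : last (last u (unzip2 p)) (unzip2 (rev_steps u p)) = u.
Proof. by case: p => //= -[e v] p; rewrite /unzip2 map_rcons last_rcons. Qed.

Lemma unzip1_rev_steps u p : unzip1 (rev_steps u p) = rev (unzip1 p).
Proof.
by elim: p u => //= -[e v] p IHp u; rewrite rev_cons -(IHp v) /unzip1 map_rcons.
Qed.

Lemma selwalk_rev u p :
  selwalk u p -> selwalk (last u (unzip2 p)) (rev_steps u p).
Proof.
elim: p u => //= -[e v] p IHp u /= /andP[ce /IHp swp].
by rewrite -cats1 selwalk_cat swp last_rev_steps /= setUC ce.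
Qed.

Lemma selwalk_traverses u p x e : selwalk u p ->
  traverses_from u p x e = (e \in unzip1 p) && (x \in c e).
Proof.
elim: p u => //= -[f v] p IHp u /= /andP[/eqP cf /IHp ->]; rewrite inE [e == f]eq_sym.
have [<-|_] := eqVneq f e; rewrite ?andbF //= andbT cf !inE ![x == _]eq_sym.
by case: (u == x); case: (v == x); rewrite //= andbF.
Qed.

Lemma traverses_anchors u p x e :
  traverses_from u p x e -> x \in u :: unzip2 p.
Proof.
elim: p u => //= -[f v] p IHp u /=.
case/or3P=> [/andP[/eqP-> _]|/andP[_ /eqP->]|/IHp].
- by rewrite inE eqxx.
- by rewrite !inE eqxx orbT.
- by rewrite [x \in u :: _]inE => ->; rewrite orbT.
Qed.

Lemma traverses_edges u p x e : traverses_from u p x e -> e \in unzip1 p.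
Proof.
elim: p u => //= -[f v] p IHp u /=; rewrite inE [e == f]eq_sym.
by case/or3P=> [/andP[_ ->]|/andP[-> _]|/IHp->] //; rewrite orbT.
Qed.

(** In a trail each edge has a single step, so the vertices traversed via it are the two ends of
    that step. *)
Lemma traverses_selwalk u p : uniq (unzip1 p) ->
    (forall x e, e \in unzip1 p -> (x \in c e) = traverses_from u p x e) ->
  selwalk u p.
Proof.
elim: p u => //= -[e v] p IHp u /= /andP[ep up] Hc; apply/andP; split.
  apply/eqP/setP => x; rewrite Hc ?mem_head // eqxx andbT /= !inE ![x == _]eq_sym.
  by rewrite (negbTE (contra (@traverses_edges _ _ _ _) ep)) orbF.
apply: IHp => // x f fp; rewrite Hc ?inE ?fp ?orbT //.
by rewrite (_ : (e == f) = false) ?andbF //; apply: contraNF ep => /eqP->.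
Qed.

Lemma walk_selwalk_mem u p e : walk_from u p -> selwalk u p -> e \in unzip1 p ->
  c e \subset inc e /\ #|c e| = 2.
Proof.
elim: p u => //= -[f v] p IHp u /= /andP[/and3P[uv uf vf] wp] /andP[/eqP cf swp].
rewrite inE => /predU1P[->|]; last exact: IHp wp swp.
by rewrite cf cards2 uv; split=> //; rewrite subUset !sub1set uf.
Qed.

(** The closed walk is cut at an occurrence of [x] and its two pieces are swapped. *)
Lemma selwalk_rot u p x : selwalk u p -> last u (unzip2 p) = u ->
    x \in u :: unzip2 p ->
  exists q, [/\ selwalk x q, last x (unzip2 q) = x & perm_eq (unzip1 q) (unzip1 p)].
Proof.
move=> swp lp; rewrite inE => /predU1P[->|]; first by exists p.
move=> xp; have /mapP[[e v] evp xv] : x \in map snd p by [].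
case/path.splitP: evp swp lp {xp} => p1 p2 swp lp.
have lp1 : last u (unzip2 (rcons p1 (e, v))) = x.
  by rewrite /unzip2 map_rcons last_rcons.
move: swp lp; rewrite selwalk_cat lp1 {1}/unzip2 map_cat last_cat lp1.
move=> /andP[sw1 sw2] lp2.
exists (p2 ++ rcons p1 (e, v)); split.
- by rewrite selwalk_cat sw2 lp2.
- by rewrite /unzip2 map_cat last_cat lp2.
- by rewrite /unzip1 !map_cat perm_catC.
Qed.

Hypothesis c2 : forall e, #|c e| = 2.

(** Every passage through an inner anchor counts twice, so only the two ends survive modulo 2; [c2]
    ensures that the ends of a step differ. *)
Lemma selwalk_parity u p x : selwalk u p ->
  odd (count (fun e => x \in c e) (unzip1 p)) = (u == x) (+) (last u (unzip2 p) == x).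
Proof.
elim: p u => [|[e v] p IHp] u /=; first by rewrite addbb.
case/andP=> /eqP ce /IHp; rewrite oddD => ->; rewrite addbA; congr addb.
have := c2 e; rewrite ce !inE ![x == _]eq_sym cards2.
by case: (eqVneq u x) => ux; case: (eqVneq v x) => vx; rewrite ?ux ?vx ?eqxx.
Qed.

Hypothesis c_inc : forall e, c e \subset inc e.

Lemma selwalk_walk u p : selwalk u p -> walk_from u p.
Proof.
elim: p u => //= -[e v] p IHp u /= /andP[/eqP ce /IHp->]; rewrite andbT /adj_via.
have := c_inc e; have := c2 e; rewrite ce cards2 subUset !sub1set.
by case: eqVneq.
Qed.

(** A relaxed Euler family: trails may be open and may share anchors. The permutation of [enum] says
    at once that the trails repeat no edge, share none and miss none. *)
Definition trail_cover T : Prop :=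
  {in T, forall W, W.2 != [::] /\ selwalk W.1 W.2} /\
  perm_eq (flatten (map (@walk_edges H) T)) (enum (edge H)).

Lemma trail_cover_perm T T' : perm_eq T T' -> trail_cover T -> trail_cover T'.
Proof.
move=> pT [wT eT]; split; first by move=> W; rewrite -(perm_mem pT); apply: wT.
by rewrite -(permPl (perm_flatten (perm_map _ pT))).
Qed.

Lemma trail_cover_merge W1 W2 W T : trail_cover [:: W1, W2 & T] ->
    selwalk W.1 W.2 ->
    perm_eq (walk_edges W) (walk_edges W1 ++ walk_edges W2) ->
  trail_cover (W :: T).
Proof.
move=> [wT eT] swW pW; split.
  move=> W'; rewrite inE => /predU1P[->|W'T]; last by apply: wT; rewrite !inE W'T !orbT.
  split=> //; have [+ _] := wT W1 (mem_head _ _); move/perm_size: pW.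
  by rewrite size_cat !size_map -!size_eq0 => ->; rewrite addn_eq0 => /negbTE->.
by apply: perm_trans eT; rewrite /= catA perm_cat2r.
Qed.

Lemma singleton_trail_cover : exists T, trail_cover T.
Proof.
(* An arbitrary ordering of each pair [c e] orients the one-edge trails. *)
have /fin_all_exists[g gP] e : exists uv : vert H * vert H, c e = [set uv.1; uv.2].
  by have /eqP/cards2P[u [v [_ ->]]] := c2 e; exists (u, v).
exists [seq ((g e).1, [:: (e, (g e).2)]) | e <- enum (edge H)]; split.
  by move=> _ /mapP[e _ ->]; rewrite /= -gP eqxx.
by rewrite -map_comp; elim: (enum _) => //= e s; rewrite perm_cons.
Qed.

Hypothesis c_even : forall x, ~~ odd #|[set e | x \in c e]|.

Lemma trail_cover_parity T x : trail_cover T ->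
  ~~ odd (count (fun e => x \in c e) (flatten (map (@walk_edges H) T))).
Proof.
case=> _ /permP->.
suff -> : count (fun e => x \in c e) (enum (edge H)) = #|[set e | x \in c e]|.
  exact: c_even.
by rewrite cardsE cardE -size_filter enumT.
Qed.

(** The degree at the end of [W1] is even while [W1] contributes an odd count there, so some other
    trail does too, and exactly one of its ends is that vertex. *)
Lemma trail_cover_open W1 T : trail_cover (W1 :: T) -> walk_start W1 != walk_end W1 ->
  exists W T', trail_cover (W :: T') /\ size T' < size T.
Proof.
move=> TC; have [wT _] := TC; have [_ sw1] := wT W1 (mem_head _ _) => open1.
have := trail_cover_parity (walk_end W1) TC.
rewrite /= count_cat oddD (selwalk_parity _ sw1) (negbTE open1) eqxx addTb negbK.
case/odd_count_flatten=> _ /mapP[W2 W2T ->].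
have [_ sw2] : W2.2 != [::] /\ selwalk W2.1 W2.2 by apply: wT; rewrite inE W2T orbT.
rewrite (selwalk_parity _ sw2) => odd2.
have TC' : trail_cover [:: W1, W2 & rem W2 T].
  by apply: trail_cover_perm TC; rewrite perm_cons perm_to_rem.
have ltT : size (rem W2 T) < size T by rewrite size_rem //; case: (T) W2T.
have [start2|start2] := eqVneq W2.1 (walk_end W1).
  exists (W1.1, W1.2 ++ W2.2), (rem W2 T); split=> //.
  apply: trail_cover_merge TC' _ _; first by rewrite selwalk_cat sw1 -[last _ _]start2.
  by rewrite /walk_edges /unzip1 map_cat.
(* [W2] arrives at the end of [W1] instead of leaving from it, so it is appended in reverse. *)
move: odd2; rewrite (negbTE start2) addFb => /eqP end2.
exists (W1.1, W1.2 ++ rev_steps W2.1 W2.2), (rem W2 T); split=> //.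
apply: trail_cover_merge TC' _ _.
  by rewrite selwalk_cat sw1 -[last _ _]end2 selwalk_rev.
rewrite /walk_edges /= /unzip1 map_cat perm_cat2l -!/(unzip1 _).
by rewrite unzip1_rev_steps perm_rev.
Qed.

(** Once rotated to start at a common anchor, the two closed trails compose. *)
Lemma trail_cover_meet W1 W2 T : trail_cover [:: W1, W2 & T] ->
    walk_start W1 = walk_end W1 -> walk_start W2 = walk_end W2 ->
    has (mem (anchors W1)) (anchors W2) ->
  exists W, trail_cover (W :: T).
Proof.
move=> TC cl1 cl2 /hasP[x xW2 xW1]; have [wT _] := TC.
have [_ sw1] := wT W1 (mem_head _ _).
have [_ sw2] : W2.2 != [::] /\ selwalk W2.1 W2.2 by apply: wT; rewrite !inE eqxx orbT.
have [q1 [swq1 lq1 pq1]] := selwalk_rot sw1 (esym cl1) xW1.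
have [q2 [swq2 lq2 pq2]] := selwalk_rot sw2 (esym cl2) xW2.
exists (x, q1 ++ q2); apply: trail_cover_merge TC _ _.
  by rewrite selwalk_cat swq1 lq1.
by rewrite /walk_edges /= /unzip1 map_cat perm_cat.
Qed.

Lemma euler_trail_cover : exists2 T, trail_cover T &
  {in T, forall W, walk_start W = walk_end W} /\
  pairwise (fun W W' => ~~ has (mem (anchors W)) (anchors W')) T.
Proof.
(* Induction on the number of trails, which each merge lowers. *)
have [T] := singleton_trail_cover; have [n] := ubnP (size T).
elim: n T => // n IHn T /ltnSE leTn TC.
have [/allP clT|/allPn[W1 W1T open1]] :=
  boolP (all (fun W => walk_start W == walk_end W) T); last first.
  have pT := perm_to_rem W1T.
  have [W [T' [TC' ltT']]] := trail_cover_open (trail_cover_perm pT TC) open1.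
  by apply: IHn TC'; apply: leq_trans leTn; rewrite (perm_size pT).
have [dT|/pairwiseN[W1 [W2 [T' [pT /negPn meet12]]]]] :=
  boolP (pairwise (fun W W' => ~~ has (mem (anchors W)) (anchors W')) T).
  by exists T => //; split=> // W /clT/eqP.
have [||W TC'] := trail_cover_meet (trail_cover_perm pT TC) _ _ meet12.
- by apply/eqP/clT; rewrite (perm_mem pT) mem_head.
- by apply/eqP/clT; rewrite (perm_mem pT) !inE eqxx orbT.
by apply: IHn TC'; apply: leq_trans leTn; rewrite (perm_size pT).
Qed.

End SelectedWalks.

(** * Equivalence of Euler families and even selections *)

Section EulerSelections.
Variable H : hypergraph.
Implicit Types (c : edge H -> {set vert H}) (T : seq (walk_data H)).

(** The traversal clause is kept for the condition at the collapsed vertex. *)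
Lemma euler_family_of_selection c : even_selection c ->
  exists2 T, euler_family T &
    forall x e, x \in c e -> exists2 W, W \in T & traverses_via W x e.
Proof.
case=> c_inc c2 c_even.
have [T [wT eT] [clT dT]] := euler_trail_cover c2 c_even.
have ex_edge e : exists2 W, W \in T & e \in walk_edges W.
  by apply/flatten_mapP; rewrite (perm_mem eT) mem_enum.
have sw W : W \in T -> selwalk c W.1 W.2 by case/wT.
have trav W x e : W \in T -> e \in walk_edges W -> x \in c e -> traverses_via W x e.
  by move=> WT eW xe; rewrite /traverses_via (selwalk_traverses _ _ (sw W WT)) eW.
have anch_sym : symmetric
    (fun W W' : walk_data H => ~~ has (mem (anchors W)) (anchors W')).
  by move=> W W'; rewrite has_sym.
have dTin := pairwise_sym_in anch_sym dT.
exists T; last by move=> x e xe; have [W WT eW] := ex_edge e; exists W; rewrite ?trav.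
split=> //.
(* A trail shares its start with itself, so pairwise anchor-disjointness excludes repetitions. *)
- rewrite uniq_pairwise; apply: sub_pairwise dT => W W' /=; apply: contraNneq => ->.
  by rewrite /= mem_head.
- move=> W WT; have [W0 swW] := wT W WT; have c_W := clT W WT.
  rewrite /is_closed_trail /is_trail /is_walk (selwalk_walk c2 c_inc swW) /=.
  rewrite (uniq_flatten_mem (_ : uniq (flatten (map (@walk_edges H) T)))) ?map_f //;
    last first.
    by rewrite (perm_uniq eT) enum_uniq.
  (* A closed trail with a single edge would make [c e] a singleton. *)
  rewrite /is_closed c_W eqxx /=; move: W0 swW c_W; rewrite /walk_start /walk_end.
  case: (W) => u [|[e v] [|? ?]] //= _ /andP[/eqP ce _] uv.
  by have := c2 e; rewrite ce cards2 uv eqxx.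
(* A common edge [e] would give a common anchor, namely any vertex of [c e]. *)
- move=> W W' WT W'T WW'; apply: contra (dTin W W' WT W'T WW') => /hasP[e eW' eW].
  have [x xe] : exists x, x \in c e by apply/card_gt0P; rewrite c2.
  apply/hasP; exists x.
    exact: traverses_anchors (trav W' x e W'T eW' xe).
  exact: traverses_anchors (trav W x e WT eW xe).
Qed.

(** The vertices selected in an edge are those traversed via it; a closed trail contributes an even
    degree everywhere. *)
Lemma selection_of_euler_family T : euler_family T ->
  exists2 c, even_selection c &
    forall x e W, W \in T -> traverses_via W x e -> x \in c e.
Proof.
case=> uT ctT deT _ coverT.
pose c e := [set x | has (fun W => traverses_via W x e) T].
have sw W : W \in T -> selwalk c W.1 W.2.
  move=> WT; have /andP[/andP[_ uW] _] := ctT W WT.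
  apply: traverses_selwalk => // x e eW; rewrite inE.
  apply/hasP/idP => [[W' W'T tr]|tr]; last by exists W.
  have [<- //|WW'] := eqVneq W' W.
  by have /hasPn/(_ e eW)/negP[] := deT _ _ W'T WT WW'; apply: traverses_edges tr.
have c_inc2 e : c e \subset inc e /\ #|c e| = 2.
  have [W WT eW] := coverT e; have /andP[/andP[wW _] _] := ctT W WT.
  exact: walk_selwalk_mem wW (sw W WT) eW.
exists c; last by move=> x e W WT tr; rewrite inE; apply/hasP; exists W.
split=> [e|e|x]; [by case: (c_inc2 e)|by case: (c_inc2 e)|].
(* Disjointness and coverage make the edges of the trails an enumeration of all edges, so degrees
   are summed trail by trail. *)
have pT : perm_eq (flatten (map (@walk_edges H) T)) (enum (edge H)).
  apply: uniq_perm; rewrite ?enum_uniq //.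
    by apply: uniq_flatten_map => // W /ctT/andP[/andP[]].
  by move=> e; rewrite mem_enum; apply/flatten_mapP.
have -> : #|[set e | x \in c e]| = count (fun e => x \in c e) (enum (edge H)).
  by rewrite cardsE cardE -size_filter enumT.
rewrite -(permP pT); apply/negP => /odd_count_flatten[_ /mapP[W WT ->]].
have /andP[_ /andP[/eqP clW _]] := ctT W WT.
rewrite (selwalk_parity _ _ (sw W WT)); last by move=> e; case: (c_inc2 e).
by rewrite -/(walk_end W) -clW addbb.
Qed.

Lemma has_euler_familyP : has_euler_family H <-> exists c, even_selection c.
Proof.
split=> [[T /selection_of_euler_family[c]]|[c /euler_family_of_selection[T]]].
  by exists c.
by exists T.
Qed.

End EulerSelections.

(** * Reachability, and edges that meet a component *)

Section Components.

Definition reach (H : hypergraph) (u v : vert H) : Prop :=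
  exists W : walk_data H, [/\ is_walk W, walk_start W = u & walk_end W = v].

Lemma reach_trans (H : hypergraph) (v u w : vert H) :
  reach u v -> reach v w -> reach u w.
Proof.
rewrite /reach /is_walk /walk_start /walk_end.
case=> -[a p] /= [wp au lp] [[b q] /= [wq bv lq]].
rewrite {a}au in wp lp; rewrite {b}bv in wq lq.
exists (u, p ++ q); split=> //=.
  by elim: p u wp lp => [|[e x] p IHp] u /= => [_ ->|/andP[-> /IHp h] /h].
by rewrite /unzip2 map_cat last_cat -!/(unzip2 _) lp.
Qed.

Lemma reach_adj (H : hypergraph) (e : edge H) (u v : vert H) :
  u \in inc e -> v \in inc e -> reach u v.
Proof.
move=> ue ve; have [<-|uv] := eqVneq u v; first by exists (u, [::]).
by exists (u, [:: (e, v)]); split; rewrite /is_walk //= /adj_via uv ue ve.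
Qed.

Lemma reach_map (H K : hypergraph) (f : vert H -> vert K) (g : edge H -> edge K) :
    injective f -> (forall e x, x \in inc e -> f x \in inc (g e)) ->
  forall u v, reach u v -> reach (f u) (f v).
Proof.
rewrite /reach /is_walk /walk_start /walk_end.
move=> f_inj fg u v [[a p] /= [wp au lp]]; rewrite {a}au in wp lp.
exists (f u, [seq (g ev.1, f ev.2) | ev <- p]); split=> //=; last first.
  by rewrite -lp -(last_map f) /unzip2 -!map_comp.
elim: p u {lp} wp => //= -[e x] p IHp u /= /andP[/and3P[ux ue xe] /IHp->].
by rewrite /adj_via inj_eq // ux !fg.
Qed.

Variable H : hypergraph.

(** Adding [e] and all its vertices to the component keeps it connected and free of empty edges, so
    by maximality they were in it already. *)
Lemma component_edge_closed (U : {set vert H}) (D : {set edge H}) (e : edge H) :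
  is_component U D -> inc e :&: U != set0 -> inc e \subset U.
Proof.
case=> -[U0 [connU neD]] maxU /set0Pn[x /setIP[xe xU]].
pose U' := U :|: inc e; pose D' := e |: D.
have sUU' : U \subset U' by apply: subsetUl.
have sDD' : D \subset D' by apply: subsetUr.
suff /(maxU _ _ sUU' sDD')[<- _] : connected_sub U' D' by apply: subsetUr.
have U'0 : U' != set0 by apply/set0Pn; exists x; apply: (subsetP sUU').
exists U'0; split; last first.
  case=> f fD' /=; have [fe|fe] := eqVneq f e.
    by apply/set0Pn; exists (exist _ x (subsetP sUU' x xU)); rewrite inE fe.
  have fD : f \in D by move: fD'; rewrite !inE (negbTE fe).
  have /set0Pn[[y yU]] := neD (exist _ f fD); rewrite inE /= => yf.
  by apply/set0Pn; exists (exist _ y (subsetP sUU' y yU)); rewrite inE.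
pose K := subhypergraph U0 D; pose K' := subhypergraph U'0 D'.
pose i (y : vert K) : vert K' := exist _ (val y) (subsetP sUU' _ (valP y)).
pose j (f : edge K) : edge K' := exist _ (val f) (subsetP sDD' _ (valP f)).
have i_inj : injective i by move=> y z [/val_inj].
have ij (f : edge K) (y : vert K) : y \in inc f -> i y \in inc (j f) by rewrite !inE.
pose x0 : vert K := exist _ x xU.
pose e' : edge K' := exist _ e (setU11 e D).
have x0e' : i x0 \in inc e' by rewrite inE.
(* The vertex [x0], common to [U] and [e], is linked to all others: inside [U] by the old walks,
   outside through [e]. *)
have hub (y : vert K') : reach (i x0) y /\ reach y (i x0).
  case: y => y yU'; have [yU|yU] := boolP (y \in U).
    have -> : exist _ y yU' = i (exist _ y yU) by apply: val_inj.
    by split; apply: (reach_map i_inj ij); apply: connU.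
  have ye : y \in inc e by move: yU'; rewrite inE (negbTE yU).
  by split; apply: (@reach_adj K' e'); rewrite ?inE.
by move=> y z; apply: (@reach_trans K' (i x0)); case: (hub y); case: (hub z).
Qed.

End Components.

(** * Cardinalities across subtypes, and double counting *)

Section FiniteSets.

Lemma card_sig_preim (T : finType) (P : pred T) (A : {set T}) :
  (forall x, x \in A -> P x) -> #|[set y : {x | P x} | val y \in A]| = #|A|.
Proof.
move=> sAP; rewrite -(card_imset _ val_inj); apply: eq_card => x.
apply/imsetP/idP => [[y + ->]|xA]; first by rewrite inE.
by exists (exist _ x (sAP x xA)); rewrite ?inE.
Qed.

Lemma card_option_set (T : finType) (A : {set option T}) :
  #|A| = (None \in A) + #|[set x | Some x \in A]|.
Proof.
have Some_inj : injective (@Some T) by move=> x y [].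
rewrite (cardsD1 None); congr addn.
rewrite -(card_imset _ Some_inj); apply: eq_card => -[x|].
  by rewrite mem_imset ?inE.
by rewrite !inE eqxx; apply/esym/imsetP => -[].
Qed.

(** Carries a selection on an induced or collapsed hypergraph, whose edges and original vertices
    form subtypes, back to [H] with the same degrees; edges lost in the passage get the empty
    set. *)
Lemma extend_sig_family (T E : finType) (P : pred T) (Q : pred E)
    (c : {e | Q e} -> {set {x | P x}}) :
  exists d : E -> {set T},
    [/\ forall e, ~~ Q e -> d e = set0, forall g, d (val g) = val @: c g
      & forall x, #|[set e | val x \in d e]| = #|[set g | x \in c g]|].
Proof.
pose d e := if (insub e : option {e | Q e}) is Some g then val @: c g else set0.
have dE g : d (val g) = val @: c g by rewrite /d valK.
have d0 e : ~~ Q e -> d e = set0 by move=> Qe; rewrite /d insubN.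
exists d; split=> // x; rewrite -[RHS](card_imset _ val_inj); apply: eq_card => e.
rewrite inE; apply/idP/imsetP => [|[g + ->]]; last first.
  by rewrite inE dE => xg; apply: imset_f.
have [Qe|/d0->] := boolP (Q e); last by rewrite inE.
have -> : e = val (exist _ e Qe : {e | Q e}) by [].
by rewrite dE mem_imset; [exists (exist _ e Qe); rewrite ?inE | apply: val_inj].
Qed.

Lemma odd_sum (I : finType) (P : pred I) (f : I -> nat) :
  odd (\sum_(i | P i) f i) = \big[addb/false]_(i | P i) odd (f i).
Proof. exact: (big_morph odd oddD (erefl : odd 0 = false)). Qed.

(* Double counting of the incidences between [A] and the family [c]. *)
Lemma even_card_crossing (T E : finType) (c : E -> {set T}) (A : {set T}) :
    (forall e, #|c e| = 2) -> (forall x, ~~ odd #|[set e | x \in c e]|) ->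
  ~~ odd #|[set e | (c e :&: A != set0) && (c e :&: ~: A != set0)]|.
Proof.
move=> c2 c_even.
have <- : odd (\sum_(x in A) #|[set e | x \in c e]|) =
    odd #|[set e | (c e :&: A != set0) && (c e :&: ~: A != set0)]|; last first.
  by rewrite odd_sum big1 // => x _; apply/negbTE.
have -> : \sum_(x in A) #|[set e | x \in c e]| = \sum_e #|c e :&: A|.
  under eq_bigr do rewrite -sum1_card big_mkcond.
  rewrite exchange_big /=; apply: eq_bigr => e _.
  rewrite -sum1_card -big_mkcondr; apply: eq_bigl => x.
  by rewrite !inE andbC.
rewrite -sum1_card [in RHS]big_mkcond !odd_sum; apply: eq_bigr => e _.
(* Two vertices are split between [A] and its complement, so the part in [A] is odd exactly when the
   edge crosses. *)
rewrite inE -!card_gt0; have := c2 e; rewrite -(cardsID A) setDE.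
by move: #|c e :&: A| #|c e :&: ~: A| => [|[|[|m]]] [|[|[|n]]].
Qed.

End FiniteSets.

(** * The two sides of the cut *)

Section CutReduction.
Variables (H : hypergraph) (F : {set edge H}) (V : bool -> {set vert H}).
Hypothesis V_neq0 : forall i, V i != set0.
Hypothesis VC : forall i, V (~~ i) = ~: V i.
Hypothesis sideF : forall e, e \notin F -> exists i, inc e \subset V i.

Lemma side_inj (A : {set vert H}) i j :
  A \subset V i -> A :&: V j != set0 -> i = j.
Proof.
move=> sAi /set0Pn[x /setIP[/(subsetP sAi) xi xj]].
have [// | neq_ij] := eqVneq i j.
have ji : j = ~~ i by case: i j neq_ij {sAi xi xj} => [] [].
by move: xj; rewrite ji VC inE xi.
Qed.

(** * Gluing selections of the two sides *)

Section Assigned.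
Variable alpha : {f : edge H | f \in F} -> Z2pair.
Local Notation a := (assigned_edge V alpha).

Lemma assigned_edge_in f :
  a (val f) = let: (i, j) := Z2pair_ends (alpha f) in inc (val f) :&: (V i :|: V j).
Proof. by rewrite /assigned_edge valK. Qed.

Lemma assigned_edge_notin e : e \notin F -> a e = inc e.
Proof. by move=> eF; rewrite /assigned_edge insubN. Qed.

Lemma assigned_edge_sub e : a e \subset inc e.
Proof.
have [eF|/assigned_edge_notin-> //] := boolP (e \in F).
rewrite -[e]/(val (exist _ e eF : {f | f \in F})) assigned_edge_in.
by case: Z2pair_ends => i j; apply: subsetIl.
Qed.

(** Edges outside [F] lie on one side, and the values 00 and 11 trim an edge to one side. *)
Lemma assigned_edge_crossing e i :
    a e :&: V i != set0 -> a e :&: V (~~ i) != set0 ->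
  exists2 f : {f | f \in F}, val f = e & alpha f = p01.
Proof.
have [eF|eF] := boolP (e \in F); last first.
  rewrite assigned_edge_notin //; have [j sej] := sideF eF.
  by move=> /(side_inj sej)<- /(side_inj sej); case: (j).
pose f : {f | f \in F} := exist _ e eF; rewrite -[e]/(val f) assigned_edge_in.
case fa: (alpha f) => /=; rewrite ?setUid.
- by move=> /(side_inj (subsetIr _ _))<- /(side_inj (subsetIr _ _)).
- by exists f.
- by move=> /(side_inj (subsetIr _ _))<- /(side_inj (subsetIr _ _)).
Qed.

Lemma assigned_edge_neq0 e : no_empty_edges H -> edge_cut_assignment V alpha ->
  a e != set0.
Proof.
move=> ne assg; have [eF|eF] := boolP (e \in F); last by rewrite assigned_edge_notin.
pose f : {f | f \in F} := exist _ e eF; rewrite -[e]/(val f) assigned_edge_in.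
have [] := assg f; case: (alpha f) => h01 h00 h11 /=.
- by rewrite setUid -card_gt0 ltnW // h00.
- have [] := h01 erefl; rewrite setIUr => /set0Pn[x xf] _.
  by apply/set0Pn; exists x; rewrite inE xf.
- by rewrite setUid -card_gt0 ltnW // h11.
Qed.

Lemma sub_side i (A : {set vert H}) : A :&: V (~~ i) = set0 -> A \subset V i.
Proof. by rewrite VC -setDE => /eqP; rewrite setD_eq0. Qed.

(* The part in [V j] of an even selection of [H]: one or two vertices of each edge
   of H^alpha that meets [V j], according to whether it also meets the other side. *)
Definition half_selection j (d : edge H -> {set vert H}) : Prop :=
  [/\ forall e, d e \subset a e :&: V j,
      forall e, #|d e| = if a e :&: V j == set0 then 0
                         else if a e :&: V (~~ j) == set0 then 2 else 1
    & forall x, x \in V j -> ~~ odd #|[set e | x \in d e]|].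

(** An edge of H^alpha on one side gets 2 + 0 vertices, a crossing one 1 + 1; the degree of a vertex
    comes entirely from its own side. *)
Lemma half_selection_glue (d : bool -> edge H -> {set vert H}) :
    (forall e, a e != set0) -> (forall j, half_selection j (d j)) ->
  exists c, even_selection (H := H) c.
Proof.
move=> a0 hd; exists (fun e => d false e :|: d true e).
have dV j e : d j e \subset V j.
  by have [/(_ e) + _ _] := hd j; rewrite subsetI => /andP[].
have dj e : d false e :&: d true e = set0.
  apply/eqP; rewrite setI_eq0; apply: disjointWl (dV _ _) _; apply: disjointWr (dV _ _) _.
  by rewrite -setI_eq0 -[true]/(~~ false) VC setICr.
split=> [e|e|x].
- rewrite subUset; apply/andP; split; apply: subset_trans (assigned_edge_sub e);
    by [have [/(_ e) + _ _] := hd false; rewrite subsetI => /andP[]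
       |have [/(_ e) + _ _] := hd true; rewrite subsetI => /andP[]].
- rewrite cardsU dj cards0 subn0.
  have [_ -> _] := hd false; have [_ -> _] := hd true; rewrite /=.
  have [a0f|] := eqVneq (a e :&: V false); have [a0t|] := eqVneq (a e :&: V true) => //.
  have /set0Pn[x xa] := a0 e; case/negP: (in_set0 x).
  by have := subsetP (sub_side (i := false) a0t) x xa; rewrite -a0f inE xa => ->.
- have [j xj] : exists j, x \in V j.
    have [|xf] := boolP (x \in V false); first by exists false.
    by exists true; rewrite -[true]/(~~ false) VC inE.
  have [_ _ /(_ x xj)] := hd j; congr (~~ odd _); apply: eq_card => e; rewrite !inE.
  have : x \notin d (~~ j) e.
    by apply: contraL xj => /(subsetP (dV _ _)); rewrite VC inE.
  by case: (j) => /negbTE->; rewrite ?orbF.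
Qed.

Lemma half_selection_induced j :
    preimage alpha p01 = set0 ->
    has_euler_family (induced (H := assigned V alpha) (V_neq0 j)) ->
  exists d, half_selection j d.
Proof.
move=> no01 /has_euler_familyP[c [c_inc c2 c_even]].
have [d [d0 dE dx]] := extend_sig_family c; exists d; split.
- move=> e; have [Qe|/d0->] := boolP (e \in [set e | a e :&: V j != set0]);
    last exact: sub0set.
  pose g : edge (induced (H := assigned V alpha) (V_neq0 j)) := exist _ e Qe.
  rewrite -[e]/(val g) dE; apply/subsetP => _ /imsetP[x xg ->].
  by rewrite inE (valP x) andbT; have := subsetP (c_inc g) x xg; rewrite inE.
- move=> e; have [Qe|Qe] := boolP (e \in [set e | a e :&: V j != set0]); last first.
    by rewrite d0 // cards0; move: Qe; rewrite inE negbK => ->.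
  pose g : edge (induced (H := assigned V alpha) (V_neq0 j)) := exist _ e Qe.
  rewrite -[e in LHS]/(val g) dE card_imset; last exact: val_inj.
  rewrite c2; move: (Qe); rewrite inE => aej; rewrite (negbTE aej).
  (* Without the value 01 no edge crosses, so the one-vertex case is impossible. *)
  case: eqP => // /eqP /(assigned_edge_crossing aej)[f _ fa].
  by have := in_set0 f; rewrite -no01 inE fa eqxx.
- by move=> x xj; have := c_even (exist _ x xj); rewrite -dx.
Qed.

Lemma half_selection_collapse i : collapse_euler V alpha i ->
  exists d, half_selection (~~ i) d.
Proof.
case=> T /selection_of_euler_family[c [c_inc c2 c_even] trav] colT.
pose c' g := [set x | Some x \in c g].
have [d [d0 dE dx]] := extend_sig_family c'.
have aD e : (1 <= #|a e :\: V i|) = (a e :&: V (~~ i) != set0).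
  by rewrite VC -setDE card_gt0.
exists d; split.
- move=> e; have [Qe|/d0->] := boolP (1 <= #|a e :\: V i|); last exact: sub0set.
  pose g : edge (collapse (H := assigned V alpha) (V i)) := exist _ e Qe.
  rewrite -[e]/(val g) dE; apply/subsetP => _ /imsetP[x xg ->].
  rewrite VC !inE (valP x) andbT; move: xg; rewrite inE => xg.
  by have := subsetP (c_inc g) _ xg; rewrite inE.
- move=> e; have [Qe|Qe] := boolP (1 <= #|a e :\: V i|); last first.
    by rewrite d0 // cards0; move: Qe; rewrite aD negbK => ->.
  pose g : edge (collapse (H := assigned V alpha) (V i)) := exist _ e Qe.
  rewrite -[e in LHS]/(val g) dE card_imset; last exact: val_inj.
  move: (Qe); rewrite aD => ae; rewrite (negbTE ae) negbK.
  have := c2 g; rewrite card_option_set -/(c' g).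
  (* An edge selects the collapsed vertex exactly when it crosses; the traversal clause gives the
     direction from crossing to selection. *)
  suff -> : (None \in c g) = (a e :&: V i != set0) by case: eqP => _; [|case].
  apply/idP/idP => [Ng|aei]; first by have := subsetP (c_inc g) _ Ng; rewrite inE.
  have [f fe fa] := assigned_edge_crossing aei ae.
  have [|g' g'f [W WT tr]] := colT f; first by rewrite inE fa.
  have -> : g = g' by apply: val_inj; rewrite g'f.
  exact: trav WT tr.
- move=> x; rewrite VC inE => xi.
  pose y : {x | x \notin V i} := exist _ x xi; rewrite -[x]/(val y) dx.
  by have := c_even (Some y); congr (~~ odd _); apply: eq_card => g; rewrite !inE.
Qed.

End Assigned.

(** * Restricting a selection of [H] to the two sides *)

Section Selected.
Variables (c : edge H -> {set vert H}) (c_sel : even_selection c).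

Definition induced_assignment (f : {f : edge H | f \in F}) : Z2pair :=
  if c (val f) \subset V false then p00
  else if c (val f) \subset V true then p11 else p01.

Local Notation alpha := induced_assignment.
Local Notation a := (assigned_edge V alpha).

Lemma sel_sub e : c e \subset inc e. Proof. by case: c_sel. Qed.
Lemma sel_card e : #|c e| = 2. Proof. by case: c_sel. Qed.
Lemma sel_even x : ~~ odd #|[set e | x \in c e]|. Proof. by case: c_sel. Qed.

Lemma sel_meets e i : ~~ (c e \subset V i) = (c e :&: V (~~ i) != set0).
Proof. by rewrite VC -setDE setD_eq0. Qed.

(** The sides are complementary, so a pair contained in neither of them meets both. *)
Lemma induced_assignment_crossing f i : alpha f = p01 <->
  c (val f) :&: V i != set0 /\ c (val f) :&: V (~~ i) != set0.
Proof.
have -> : c (val f) :&: V i = c (val f) :&: V (~~ ~~ i) by rewrite negbK.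
rewrite -!sel_meets /alpha.
by case: i => /=; case: (_ \subset V false); case: (_ \subset V true); split=> // -[].
Qed.

Lemma induced_assignmentP : edge_cut_assignment V alpha.
Proof.
move=> f; split=> [/(induced_assignment_crossing _ false)[]||]; rewrite /alpha.
- have meets i : c (val f) :&: V i != set0 -> inc (val f) :&: V i != set0.
    case/set0Pn=> x /setIP[xc xV]; apply/set0Pn; exists x.
    by rewrite inE xV (subsetP (sel_sub _)).
  by move=> /meets ? /meets.
- case: ifP => [cV _|_]; last by case: ifP.
  by rewrite -(sel_card (val f)) subset_leq_card // subsetI sel_sub.
- case: ifP => // _; case: ifP => // cV _.
  by rewrite -(sel_card (val f)) subset_leq_card // subsetI sel_sub.
Qed.

Lemma sel_sub_assigned e : c e \subset a e.
Proof.
have [eF|/assigned_edge_notin->] := boolP (e \in F); last exact: sel_sub.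
pose f : {f | f \in F} := exist _ e eF; rewrite -[e]/(val f) assigned_edge_in /alpha.
case: ifP => [cV|_]; last case: ifP => [cV|_].
- by rewrite /= setUid subsetI sel_sub.
- by rewrite /= setUid subsetI sel_sub.
- by rewrite /= -[true]/(~~ false) VC setUCr setIT sel_sub.
Qed.

(** If [c e] missed [V i], it would lie on the other side; then [a e] meets both sides, [e] has
    value 01, and [c e] crosses after all. *)
Lemma sel_meets_assigned e i : a e :&: V i != set0 -> c e :&: V i != set0.
Proof.
move=> aei; apply/negP => /eqP cei.
have cei' : c e \subset V (~~ i) by apply: sub_side; rewrite negbK.
have aei' : a e :&: V (~~ i) != set0.
  have /card_gt0P[x xc] : 0 < #|c e| by rewrite sel_card.
  apply/set0Pn; exists x; rewrite inE (subsetP (sel_sub_assigned e)) //.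
  exact: (subsetP cei').
have [f fe /(induced_assignment_crossing _ i)] := assigned_edge_crossing aei aei'.
by rewrite fe cei eqxx => -[].
Qed.

(** By [sideF], an edge whose selected pair crosses belongs to [F], so counting inside [F] loses
    nothing. *)
Lemma card_induced_crossing i :
  #|preimage alpha p01| = #|[set e | (c e :&: V i != set0) && (c e :&: ~: V i != set0)]|.
Proof.
rewrite -(@card_sig_preim _ (fun e => e \in F)).
  apply: eq_card => f; rewrite !inE -VC.
  by apply/eqP/andP => /induced_assignment_crossing.
move=> e; rewrite inE -VC => /andP[cei cei'].
apply: contraT => /sideF[j /(subset_trans (sel_sub e)) sej].
by have := side_inj sej cei'; rewrite (side_inj sej cei); case: (i).
Qed.

Lemma even_card_induced_crossing : ~~ odd #|preimage alpha p01|.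
Proof.
rewrite (card_induced_crossing true).
by apply: even_card_crossing; [apply: sel_card | apply: sel_even].
Qed.

Lemma induced_euler i : preimage alpha p01 = set0 ->
  has_euler_family (induced (H := assigned V alpha) (V_neq0 i)).
Proof.
move=> no01; apply/has_euler_familyP.
pose c' (g : edge (induced (H := assigned V alpha) (V_neq0 i))) :=
  [set x : {x | x \in V i} | val x \in c (val g)].
exists c'; split=> [g|g|x].
- apply/subsetP => x; rewrite !inE; exact: (subsetP (sel_sub_assigned _)).
- rewrite card_sig_preim ?sel_card // => x; apply/subsetP.
  (* The edge survives in [V i], so a selected vertex outside [V i] would make the pair cross,
     against the absence of the value 01. *)
  apply: sub_side; apply/eqP; apply: contraT => cei'.
  have cei : c (val g) :&: V i != set0.
    by apply: sel_meets_assigned; have := valP g; rewrite inE.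
  have := card_induced_crossing i; rewrite no01 cards0.
  move=> /esym/cards0_eq/setP/(_ (val g)).
  by rewrite !inE -VC cei cei'.
- have := sel_even (val x); congr (~~ odd _).
  rewrite -(@card_sig_preim _ (fun e => e \in [set e | a e :&: V i != set0])).
    by apply: eq_card => g; rewrite !inE.
  move=> e; rewrite !inE => xc; apply/set0Pn; exists (val x).
  by rewrite inE (valP x) (subsetP (sel_sub_assigned e)).
Qed.

Lemma induced_collapse_euler i : collapse_euler V alpha i.
Proof.
pose K := collapse (H := assigned V alpha) (V i).
have aD e : (1 <= #|a e :\: V i|) = (a e :&: V (~~ i) != set0).
  by rewrite VC -setDE card_gt0.
(* Selected vertices in [V i] become the collapsed vertex. *)
pose c' (g : edge K) : {set vert K} :=
  [set y | if y is Some x then val x \in c (val g) else c (val g) :&: V i != set0].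
have c'_sel : even_selection c'.
  split=> [g|g|[x|]].
  - apply/subsetP => -[x|]; rewrite !inE; first exact: (subsetP (sel_sub_assigned _)).
    case/set0Pn=> x /setIP[xc xi]; apply/set0Pn; exists x.
    by rewrite inE xi (subsetP (sel_sub_assigned _)).
  (* A surviving edge keeps a selected vertex outside [V i], so at most one of its two is collapsed
     and the size stays two. *)
  - have cg : c (val g) :&: ~: V i != set0.
      by rewrite -VC; apply: sel_meets_assigned; rewrite -aD; apply: (valP g).
    rewrite card_option_set inE.
    have -> : #|[set x | Some x \in c' g]| = #|c (val g) :&: ~: V i|.
      rewrite -(@card_sig_preim _ (fun x => x \notin V i)).
        by apply: eq_card => x; rewrite !inE (valP x) andbT.
      by move=> x; rewrite !inE => /andP[].
    move: cg; rewrite -!card_gt0; have := sel_card (val g).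
    rewrite -(cardsID (V i)) setDE.
    by move: #|c _ :&: V i| #|c _ :&: ~: V i| => [|[|[|m]]] [|[|[|n]]].
  - have := sel_even (val x); congr (~~ odd _).
    rewrite -(@card_sig_preim _ (fun e => 1 <= #|a e :\: V i|)).
      by apply: eq_card => g; rewrite !inE.
    move=> e; rewrite inE aD VC => xc; apply/set0Pn; exists (val x).
    by rewrite !inE (valP x) andbT (subsetP (sel_sub_assigned e)).
  (* The degree of the collapsed vertex is the number of edges with value 01. *)
  - have := even_card_induced_crossing; rewrite (card_induced_crossing i).
    congr (~~ odd _).
    rewrite -(@card_sig_preim _ (fun e => 1 <= #|a e :\: V i|)).
      apply: eq_card => g; rewrite !inE -VC; apply: andb_idr => _.
      by apply: sel_meets_assigned; rewrite -aD; apply: (valP g).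
    move=> e; rewrite inE aD -VC => /andP[_ /set0Pn[x /setIP[xc xi]]].
    by apply/set0Pn; exists x; rewrite !inE xi andbT (subsetP (sel_sub_assigned e)).
have [T eT trav] := euler_family_of_selection c'_sel; exists T => // f.
rewrite inE => /eqP/(induced_assignment_crossing _ i)[fi /set0Pn[x /setIP[xc xi]]].
have Qf : 1 <= #|a (val f) :\: V i|.
  by rewrite aD; apply/set0Pn; exists x; rewrite inE xi (subsetP (sel_sub_assigned _)).
by exists (exist _ (val f) Qf) => //; apply: trav; rewrite inE.
Qed.

End Selected.

End CutReduction.

Theorem theorem6p2 (H : hypergraph) (H_conn : connected H)
    (H_nonempty_edges : no_empty_edges H)
    (F : {set edge H}) (F_min : minimal_edge_cut F)
    (V : bool -> {set vert H})
    (V_neq0 : forall i : bool, V i != set0)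
    (V_disj : [disjoint V false & V true])
    (V_cover : V false :|: V true = [set: vert H])
    (V_comp : forall i : bool, union_of_components (H := delete_edges F) (V i)) :
  has_euler_family H <->
  exists alpha : {f : edge H | f \in F} -> Z2pair,
    [/\ edge_cut_assignment V alpha,
        ~~ odd #|preimage alpha p01| &
        (preimage alpha p01 = set0 /\
         forall i : bool,
           has_euler_family (induced (H := assigned V alpha) (V_neq0 i)))
        \/
        (preimage alpha p01 <> set0 /\
         forall i : bool, collapse_euler V alpha i)].
Proof.
have Vt : V true = ~: V false.
  apply/setP => x; rewrite inE; have := in_setT x; rewrite -V_cover inE.
  by case: (boolP (x \in V false)) => //= xf _; apply: (disjointFr V_disj).
have VC i : V (~~ i) = ~: V i by case: i; rewrite Vt ?setCK.
have sideF e : e \notin F -> exists i, inc e \subset V i.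
  (* Any vertex of the non-empty edge decides its side. *)
  move=> eF; have /set0Pn[x xe] := H_nonempty_edges e.
  have : x \in V false :|: V true by rewrite V_cover inE.
  have closed i : x \in V i -> inc e \subset V i.
    have [P compP ->] := V_comp i; case/bigcupP=> U UP xU; have [D UD] := compP U UP.
    apply: subset_trans (bigcup_sup U UP).
    apply: (component_edge_closed (e := exist _ e eF : edge (delete_edges F)) UD).
    by apply/set0Pn; exists x; rewrite inE xe.
  by rewrite inE => /orP[] /closed sei; [exists false | exists true].
split=> [/has_euler_familyP[c c_sel]|[alpha [assg _ split_or]]].
  exists (induced_assignment V c); split.
  - exact: induced_assignmentP.
  - exact: even_card_induced_crossing.
  - have [no01|some01] :=
      eqVneq (preimage (F := F) (induced_assignment V c) p01) set0.
      by left; split=> // i; apply: induced_euler.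
    by right; split=> [/eqP|i]; [apply/negP | apply: induced_collapse_euler].
have a0 e := assigned_edge_neq0 e H_nonempty_edges assg.
have half j : exists d, half_selection V alpha j d.
  (* Side [j] is what remains when the other side is collapsed, hence the instance [~~ j]. *)
  case: split_or => [[no01 /(_ j)]|[_ /(_ (~~ j))]].
    exact: half_selection_induced.
  by move/(half_selection_collapse VC sideF); rewrite negbK.
have [df hf] := half false; have [dt ht] := half true.
apply/has_euler_familyP.
by apply: (half_selection_glue VC (d := fun j => if j then dt else df) a0) => -[].
Qed.
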